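(* Let $G=(V(G),E(G),w)$ be a connected triangle-free graph with weight function $w:E(G)\to\mathbb{R}_+$ and let $T$ be any spanning tree of $G$. Then $\mathrm{mac}(G)\ge\frac{w(G)}{2}+\frac{w(T)}{4}$.
   Context: $\mathbb{R}_+$ denotes the non-negative reals; for a subgraph $H$, $w(H)=\sum_{e\in E(H)}w(e)$. $\mathrm{mac}(G)$ is the maximum total weight of the edges between $A$ and $B$ over all partitions $(A,B)$ of $V(G)$. Triangle-free means containing no $K_3$ subgraph. *)

(* Defs.v *)
From mathcomp Require Import all_boot all_order all_algebra.
From mathcomp Require Import reals.

Set Implicit Arguments.
Unset Strict Implicit.
Unset Printing Implicit Defensive.

Import Order.TTheory GRing.Theory Num.Theory.
Local Open Scope ring_scope.

Record sgraph (V : finType) := SGraph {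
  adj : rel V;
  adj_sym : symmetric adj;
  adj_irr : irreflexive adj }.

(* Edges are unordered pairs, so that each edge is counted once in sums. *)
Definition edges (V : finType) (G : sgraph V) : {set {set V}} :=
  [set f | [exists x, exists y, adj G x y && (f == [set x; y])]].

Definition edges_between (V : finType) (G : sgraph V) (A B : {set V}) :
    {set {set V}} :=
  [set f in edges G | [exists x in A, exists y in B, f == [set x; y]]].

Definition connected_graph (V : finType) (G : sgraph V) : Prop :=
  forall x y, connect (adj G) x y.

(* By irreflexivity of [adj G], such x, y, z are pairwise distinct. *)
Definition triangle_free (V : finType) (G : sgraph V) : Prop :=
  ~ exists x y z, [/\ adj G x y, adj G y z & adj G x z].

Definition acyclic (V : finType) (G : sgraph V) : Prop :=
  forall c : seq V, (2 < size c)%N -> ~ ucycle (adj G) c.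

Definition is_tree (V : finType) (G : sgraph V) : Prop :=
  connected_graph G /\ acyclic G.

(* H and G share the vertex type V, so a subgraph H is spanning. *)
Definition spanning_tree (V : finType) (H G : sgraph V) : Prop :=
  subrel (adj H) (adj G) /\ is_tree H.

(* Only the values of w on edges matter. *)
Definition weight (V : finType) (R : realType) (w : {set V} -> R)
    (H : sgraph V) : R :=
  \sum_(f in edges H) w f.

Definition cut_weight (V : finType) (R : realType) (w : {set V} -> R)
    (G : sgraph V) (A B : {set V}) : R :=
  \sum_(f in edges_between G A B) w f.

(* The default value 0 is itself attained, by the partition with A empty, so
   this is the maximum over all partitions (A, B) whatever the signs of w. *)
Definition mac (V : finType) (R : realType) (w : {set V} -> R)
    (G : sgraph V) : R :=
  \big[Num.max/0]_(A : {set V}) cut_weight w G A (~: A).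

(* Main.v *)
Require Import Defs.
From mathcomp Require Import all_boot all_order all_algebra.
From mathcomp Require Import reals ring lra.
Import Order.TTheory GRing.Theory Num.Theory.
Local Open Scope ring_scope.

(** Root T and split its edges into two classes according to the parity of the
    depth of the parent endpoint.  Each class is a disjoint union of stars,
    and in a triangle-free graph every star is an induced subgraph.  2-colour
    each star so that all its edges are cut, and flip the stars independently
    at random: edges inside a star are always cut, all other edges of G are
    cut with probability 1/2.  Hence mac(G) is at least w(G)/2 plus half the
    weight of either class, and the two classes have total weight w(T). *)

Lemma mem_edges {V : finType} (G : sgraph V) (x y : V) :
  adj G x y -> [set x; y] \in edges G.
Proof.
move=> xy; rewrite inE; apply/existsP; exists x; apply/existsP; exists y.
by rewrite xy eqxx.
Qed.

Lemma edgesP {V : finType} (G : sgraph V) (f : {set V}) :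
  reflect (exists x y, adj G x y /\ f = [set x; y]) (f \in edges G).
Proof.
apply: (iffP idP) => [|[x [y [xy ->]]]]; last exact: mem_edges.
rewrite inE => /existsP[x /existsP[y /andP[xy /eqP->]]].
by exists x, y.
Qed.

Lemma mem_edges_cut {V : finType} (G : sgraph V) (A : {set V}) (x y : V) :
  adj G x y ->
  ([set x; y] \in edges_between G A (~: A)) = ((x \in A) != (y \in A)).
Proof.
move=> xy; rewrite inE mem_edges //=; apply/idP/idP.
  case/exists_inP=> a aA /exists_inP[b bA /eqP E].
  rewrite inE in bA.
  have : a \in [set x; y] by rewrite E set21.
  have : b \in [set x; y] by rewrite E set22.
  by move: aA bA; rewrite !inE => aA bA /orP[]/eqP? /orP[]/eqP?; subst;
    rewrite ?aA ?(negbTE bA) //; rewrite aA in bA.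
case: (boolP (x \in A)) => xA; case: (boolP (y \in A)) => yA //= _.
  by apply/exists_inP; exists x => //; apply/exists_inP; exists y; rewrite ?inE.
apply/exists_inP; exists y => //; apply/exists_inP; exists x; rewrite ?inE //.
by rewrite setUC.
Qed.

Lemma cut_weight_le_mac {V : finType} {R : realType} (w : {set V} -> R)
  (G : sgraph V) (A : {set V}) : cut_weight w G A (~: A) <= mac w G.
Proof.
exact: (le_bigmax 0 (fun A => cut_weight w G A (~: A))).
Qed.

Section StarColouring.
Variables (V : finType) (rep : V -> V).

(* [b] chooses the colour of the leaves of each star; centers are the fixed
   points of [rep]. *)
Definition star_side (b : {ffun V -> bool}) : {set V} :=
  [set v | b (rep v) (+) (rep v == v)].

(** Flipping [b] at the single point [rep x] changes the side of [x] but not that of [y]. This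
    involution therefore exchanges the colourings that separate [x] from [y] with those that do
    not. *)
Lemma star_side_half (x y : V) : rep x != rep y ->
  (2 * #|[set b | (x \in star_side b) != (y \in star_side b)]|
   = #|{ffun V -> bool}|)%N.
Proof.
move=> xy; set C := [set b | _].
pose flip (b : {ffun V -> bool}) := [ffun v => b v (+) (v == rep x)].
have flipK : involutive flip.
  by move=> b; apply/ffunP=> v; rewrite !ffunE -addbA addbb addbF.
have -> : (2 * #|C| = #|C| + #|flip @: C|)%N.
  by rewrite card_imset ?mul2n ?addnn //; apply: inv_inj.
suff -> : flip @: C = ~: C by rewrite cardsC.
apply/setP=> b; rewrite -{1}[b]flipK mem_imset; last exact: inv_inj.
rewrite !inE !ffunE eqxx eq_sym [rep y == rep x]eq_sym (negbTE xy).
by case: (b _) (b _) (rep x == x) (rep y == y) => [] [] [] [].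
Qed.

End StarColouring.

(** A star forest is encoded by an idempotent [rep], which sends each vertex to the centre of its
    star. The expectation is replaced by a sum over all colourings [b]. *)
Lemma mac_star_forest (R : realType) (V : finType) (G : sgraph V)
    (w : {set V} -> R) (rep : V -> V) :
  (forall f, f \in edges G -> 0 <= w f) ->
  triangle_free G ->
  (forall v, rep (rep v) = rep v) ->
  (forall v, rep v != v -> adj G v (rep v)) ->
  weight w G
    + \sum_(f in edges G | [exists v, f == [set v; rep v]]) w f
  <= 2 * mac w G.
Proof.
move=> w_ge0 trf repK rep_adj.
set N := #|{ffun V -> bool}|.
have N_gt0 : 0 < N%:R :> R.
  by rewrite ltr0n; apply/card_gt0P; exists [ffun=> true].
pose C f :=
  [set b | f \in edges_between G (star_side V rep b) (~: star_side V rep b)].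
(* Double counting: each edge [f] contributes once for every colouring that cuts it. *)
have sumE : \sum_b cut_weight w G (star_side V rep b) (~: star_side V rep b)
    = \sum_(f in edges G) w f * #|C f|%:R.
  rewrite /cut_weight.
  under eq_bigr => b _ do rewrite /edges_between big_set big_mkcondr.
  rewrite exchange_big; apply: eq_bigr => f fG.
  rewrite -big_mkcond /= sumr_const mulr_natr; congr (_ *+ _).
  by apply: eq_card => b; rewrite [in RHS]inE /edges_between inE fG.
have sum_le : \sum_b cut_weight w G (star_side V rep b) (~: star_side V rep b)
    <= N%:R * mac w G.
  rewrite mulr_natl -sumr_const; apply: ler_sum => b _.
  exact: cut_weight_le_mac.
rewrite -(ler_pM2l N_gt0) mulrCA.
apply: le_trans (ler_wpM2l _ sum_le); last by lra.
rewrite sumE /weight big_mkcondr -big_split !mulr_sumr.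
apply: ler_sum => f fG; have := w_ge0 f fG.
case/edgesP: fG => x [y [xy ->]] w0.
have CE : C [set x; y]
    = [set b | (x \in star_side V rep b) != (y \in star_side V rep b)].
  by apply: eq_finset => b; rewrite mem_edges_cut.
case: (eqVneq (rep x) (rep y)) => [rxy|rxy].
  have -> : #|C [set x; y]| = N.
    rewrite CE; apply: eq_card => b; rewrite !inE -rxy.
    have [ex|nx] := eqVneq (rep x) x.
      have -> : rep x == y = false.
        by apply/eqP => exy; have := adj_irr G x; rewrite -{2}ex exy xy.
      by case: (b _).
    have [ey|ny] := eqVneq (rep x) y; first by case: (b _).
    (* Two adjacent leaves of one star would form a triangle with its centre. *)
    case: trf; exists x, y, (rep x); split => //; last exact: rep_adj.
    by rewrite rxy; apply: rep_adj; rewrite -rxy.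
  have -> : 2 * (w [set x; y] * N%:R) = N%:R * (w [set x; y] + w [set x; y]).
    by ring.
  by rewrite ler_pM2l // lerD2l; case: ifP.
(* An edge between different stars earns no bonus term: [v] and [rep v] always share a star. *)
rewrite ifN /= ?addr0.
  by rewrite mulrCA -natrM CE star_side_half // mulrC.
apply: contra rxy => /existsP[v /eqP E].
have rep2 z : z \in [set x; y] -> rep z = rep v.
  by rewrite E !inE => /orP[]/eqP ->.
by rewrite (rep2 x) ?set21 // (rep2 y) ?set22.
Qed.

Section Rooting.
Variables (V : finType) (e : rel V) (r : V).

Fixpoint walk (n : nat) (x : V) : bool :=
  if n is n'.+1 then [exists z, e x z && walk n' z] else x == r.

Lemma connect_walk (x : V) : connect e x r -> exists n, walk n x.
Proof.
case/connectP=> p; elim: p x => [|z p IH] x /=.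
  by move=> _ /eqP; rewrite eq_sym; exists 0%N.
case/andP=> xz /IH{}IH /IH[n zn]; exists n.+1 => /=.
by apply/existsP; exists z; rewrite xz.
Qed.

(** Take for [d] the distance to [r], and for [par v] the second vertex of a shortest walk from
    [v]. *)
Lemma rooting : (forall x, connect e x r) ->
  exists (d : V -> nat) (par : V -> V),
    d r = 0%N /\ forall v, v != r -> e v (par v) /\ d v = (d (par v)).+1.
Proof.
move=> conn; have ex v := connect_walk v (conn v).
pose d v := ex_minn (ex v).
have dP v : walk (d v) v /\ forall n, walk n v -> (d v <= n)%N.
  by rewrite /d; case: ex_minnP.
exists d, (fun v => odflt v [pick z | e v z && (d v == (d z).+1)]); split.
  by apply/eqP; rewrite -leqn0; apply: (dP r).2 => /=.
move=> v vr; case: pickP => [z /andP[? /eqP?] //|none].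
have [] := dP v; case E: (d v) => [|n] /=; first by rewrite (negbTE vr).
case/existsP => z /andP[vz zn] min.
(* The rest of the walk gives [d z <= n]; a smaller [d z] would give [v] a shorter walk through
   [z]. *)
have := none z; rewrite vz E eqSS eqn_leq (dP z).2 // andbT => /negbT/negP[].
rewrite -ltnS; apply: min => /=; apply/existsP; exists z.
by rewrite vz (dP z).1.
Qed.

End Rooting.

(** The parent edges [e] alone connect all vertices to [r]. Any other edge of [T] would close a
    cycle with an [e]-path between its ends. *)
Lemma tree_edge_parent {V : finType} (T : sgraph V) (r : V) (d : V -> nat)
    (par : V -> V) :
  acyclic T ->
  (forall v, v != r -> adj T v (par v) /\ d v = (d (par v)).+1) ->
  forall x y, adj T x y ->
    (x != r) && (par x == y) || (y != r) && (par y == x).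
Proof.
move=> acyc parP.
pose e x y := (x != r) && (par x == y) || (y != r) && (par y == x).
have e_sym : symmetric e by move=> x y; rewrite /e orbC.
have eT : subrel e (adj T).
  move=> x y /orP[]/andP[/parP[xT _] /eqP <-] //.
  by rewrite adj_sym.
have to_root x : connect e x r.
  elim: {x}(d x) {-2}x (erefl (d x)) => [|n IH] x dx.
    have [->|/parP[_]] := eqVneq x r; first exact: connect0.
    by rewrite dx.
  have [->|xr] := eqVneq x r; first exact: connect0.
  apply: (connect_trans (connect1 _) (IH (par x) _)).
    by rewrite /e xr eqxx.
  by have [_] := parP _ xr; rewrite dx => -[].
have conn x y : connect e x y.
  by apply: connect_trans (to_root x) _; rewrite (sym_connect_sym e_sym).
move=> x y xy; rewrite -/(e x y); apply/negP => /negP nexy.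
case/connectP: (conn x y) => p0 /shortenP[p pe pu _] E.
apply: (acyc (x :: p)); last first.
  apply/andP; split=> //=.
  by rewrite rcons_path (sub_path eT pe) -E adj_sym.
(* The cycle has at least three vertices: an empty path would make [xy] a loop, and a path of one
   edge would make it a parent edge. *)
case: p pe {pu} E => [|z [|? ?]] //= pe E.
  by move: xy; rewrite E adj_irr.
by move: nexy; rewrite E; move: pe; rewrite andbT => ->.
Qed.

Theorem theorem4p3 (R : realType) (V : finType) (G T : sgraph V)
    (w : {set V} -> R)
    (w_ge0 : forall f, f \in edges G -> 0 <= w f)
    (G_connected : connected_graph G)
    (G_triangle_free : triangle_free G)
    (T_spanning : spanning_tree T G) :
  mac w G >= weight w G / 2 + weight w T / 4.
Proof.
case: T_spanning => TG [Tconn Tacyc].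
have edges_sub f : f \in edges T -> f \in edges G.
  by case/edgesP=> x [y [/TG xy ->]]; apply: mem_edges.
(* Without vertices there is no root, but then all weights vanish. *)
have [r _|V0] := pickP (@predT V); last first.
  have no_edges H : weight w H = 0.
    apply: big1 => f /edgesP[x _]; by have := V0 x.
  rewrite !no_edges !mul0r addr0.
  have := cut_weight_le_mac w G set0; apply: le_trans.
  apply: sumr_ge0 => f; rewrite inE => /andP[fG _]; exact: w_ge0.
have [d [par [_ parP]]] := rooting V (adj T) r (fun x => Tconn x r).
(* Centres are the vertices with depth of parity [p]; the others hang as leaves from their parents.
   A root of the wrong parity is a star by itself. *)
pose rep p v := if (v == r) || (odd (d v) == p) then v else par v.
pose S p := \sum_(f in edges G | [exists v, f == [set v; rep p v]]) w f.
have star p : weight w G + S p <= 2 * mac w G.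
  apply: mac_star_forest => // v; rewrite {2}/rep /rep.
    case: (boolP (v == r)) => //= vr; first by rewrite vr.
    case: (boolP (odd (d v) == p)) => [->|np]; first by rewrite orbT.
    case: ifP => // /norP[_]; have [_ dv] := parP v vr.
    by move: np; rewrite dv /=; case: (odd _) p => -[].
  case: ifP => [|/norP[vr _] _]; first by rewrite eqxx.
  by apply: TG; case: (parP v vr).
have T_le : weight w T <= S true + S false.
  rewrite /S /weight big_mkcond.
  rewrite [\sum_(_ in _ | _) _]big_mkcond [X in _ <= _ + X]big_mkcond.
  rewrite -big_split.
  apply: ler_sum => f _ /=.
  case: (boolP (f \in edges G)) => [fG|]; last first.
    by case: (boolP (f \in edges T)) => [/edges_sub->|] //=; rewrite addr0.
  have wf := w_ge0 f fG.
  case: ifP => fT; last by apply: addr_ge0; case: ifP.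
  suff [[] ->] : exists p, [exists v, f == [set v; rep p v]].
  - by rewrite lerDl; case: ifP.
  - by rewrite lerDr; case: ifP.
  have [v vr ->] : exists2 v, v != r & f = [set v; par v].
    case/edgesP: fT => x [y [xy ->]].
    have /orP[] := tree_edge_parent T r d par Tacyc parP x y xy.
      by case/andP=> xr /eqP <-; exists x.
    by case/andP=> yr /eqP <-; exists y; rewrite // setUC.
  (* The edge from [v] to its parent lies in the class where [v] is a leaf. *)
  exists (~~ odd (d v)); apply/existsP; exists v.
  by rewrite /rep (negbTE vr) /=; case: (odd _).
(* Adding both bounds gives [2 * weight w G + weight w T <= 4 * mac w G]. *)
have := star true; have := star false; lra.
Qed.
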